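(* Let $N\ge2$ and let $\Omega\subset\mathbb{R}^N$ be a bounded domain with boundary $\Gamma$ satisfying the uniform interior and exterior sphere conditions with radii $r_i$ and $r_e$, and let $u\in C^1(\overline\Omega)\cap C^2(\Omega)$ be a solution of $\Delta u=N$ in $\Omega$, $u=0$ on $\Gamma$. Then $$r_i\le|\nabla u|\le c_N\,\frac{d_\Omega(d_\Omega+r_e)}{r_e}\quad\text{on }\Gamma,$$ where $d_\Omega$ is the diameter of $\Omega$, $c_N=3/2$ for $N=2$ and $c_N=N/2$ for $N\ge3$.
   Context: Uniform interior (resp. exterior) sphere condition with radius $r_i$ (resp. $r_e$): for every $p\in\Gamma$ there is a ball of radius $r_i$ contained in $\Omega$ (resp. of radius $r_e$ contained in $\mathbb{R}^N\setminus\overline\Omega$) whose closure meets $\Gamma$ only at $p$. *)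

(* Defs.v *)
From HB Require Import structures.
From mathcomp Require Import all_boot all_order all_algebra.
From mathcomp Require Import all_classical all_reals all_analysis.
Set Implicit Arguments. Unset Strict Implicit. Unset Printing Implicit Defensive.
Import Order.TTheory GRing.Theory Num.Theory.
Import numFieldNormedType.Exports.
Local Open Scope classical_set_scope.
Local Open Scope ring_scope.

Section Defs.
Variables (R : realType) (N : nat).
Notation V := 'rV[R]_N.

(* Euclidean norm (the library's norm on matrices is the sup norm). *)
Definition enorm (x : V) : R := Num.sqrt (\sum_(i < N) x ord0 i ^+ 2).

Definition ebase (i : 'I_N) : V := delta_mx ord0 i.

Definition partial (i : 'I_N) (f : V -> R) (x : V) : R := derive f x (ebase i).

Definition laplacian (f : V -> R) (x : V) : R :=
  \sum_(i < N) partial i (partial i f) x.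

Definition eball (c : V) (r : R) : set V := [set x | enorm (x - c) < r].
Definition ecball (c : V) (r : R) : set V := [set x | enorm (x - c) <= r].

Definition bounded_domain (O : set V) : Prop :=
  open O /\ connected O /\ O !=set0 /\ exists M : R, forall x, O x -> enorm x <= M.

Definition bdry (O : set V) : set V := closure O `\` O.

Definition diameter (O : set V) : R :=
  sup [set d | exists x y, O x /\ O y /\ d = enorm (x - y)].

Definition interior_sphere (O : set V) (r : R) : Prop :=
  forall p, bdry O p -> exists c : V,
    eball c r `<=` O /\ ecball c r `&` bdry O = [set p].

Definition exterior_sphere (O : set V) (r : R) : Prop :=
  forall p, bdry O p -> exists c : V,
    eball c r `<=` ~` closure O /\ ecball c r `&` bdry O = [set p].

(* u in C^1(closure O), with g i the continuous extension to closure O of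
   the i-th partial derivative of u *)
Definition C1_closure (O : set V) (u : V -> R) (g : 'I_N -> V -> R) : Prop :=
  {within closure O, continuous u} /\
  (forall x, O x -> differentiable u x /\ forall i, partial i u x = g i x) /\
  (forall i, {within closure O, continuous (g i)}).

Definition C2_on (O : set V) (u : V -> R) : Prop :=
  (forall x, O x -> differentiable u x) /\
  (forall i x, O x -> differentiable (partial i u) x) /\
  (forall i j, {in O, continuous (partial j (partial i u))}).

Definition cN : R := if N == 2%N then 3 / 2 else N%:R / 2.

End Defs.

(* Main.v *)
Require Import Defs.
From HB Require Import structures.
From mathcomp Require Import all_boot all_order all_algebra.
From mathcomp Require Import all_classical all_reals all_analysis.
From mathcomp Require Import ring lra.
Import Order.TTheory GRing.Theory Num.Theory.
Import numFieldNormedType.Exports.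
Local Open Scope classical_set_scope.
Local Open Scope ring_scope.

(** Put [d = d_O].  The maximum principle gives [u <= 0], and on the interior
    ball [B(ci, ri)] at [p] it gives [u <= (|x - ci|^2 - ri^2) / 2]; both sides
    vanish at [p], so [grad u(p) . (p - ci) >= ri^2], which is the lower bound.
    In particular [- grad u(p)] points into the interior ball.  For the upper
    bound, [u >= W] in [O] for a barrier [W] with [Lap W >= N], [W <= 0] on the
    boundary, [W p = 0] and [|grad W(p)| = K <= c_N d (d + re) / re];
    differentiating [u >= W] at [p] along [- grad u(p)] yields
    [|grad u(p)|^2 <= K |grad u(p)|], and no regularity of the boundary is used
    beyond the two balls at [p].  The barrier only uses that [O] lies outside
    the exterior ball and within distance [d] of [p]. *)

Set Implicit Arguments.
Unset Strict Implicit.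
Unset Printing Implicit Defensive.

(** * Euclidean norm and directional derivatives *)

Section Euclidean.
Variables (R : realType) (N : nat).
Local Notation V := 'rV[R]_N.
Implicit Types (x y z v c p : V) (a b : R).

Definition edot x y : R := \sum_(i < N) x ord0 i * y ord0 i.

Lemma edotC x y : edot x y = edot y x.
Proof. by apply: eq_bigr => i _; rewrite mulrC. Qed.

Lemma edotDl x y z : edot (x + y) z = edot x z + edot y z.
Proof. by rewrite -big_split; apply: eq_bigr => i _; rewrite mxE mulrDl. Qed.

Lemma edotZl a x y : edot (a *: x) y = a * edot x y.
Proof. by rewrite mulr_sumr; apply: eq_bigr => i _; rewrite mxE mulrA. Qed.

Lemma edot0l x : edot 0 x = 0.
Proof. by rewrite -(scale0r x) edotZl mul0r. Qed.

Lemma edotNl x y : edot (- x) y = - edot x y.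
Proof. by rewrite -scaleN1r edotZl mulN1r. Qed.

Lemma edotBl x y z : edot (x - y) z = edot x z - edot y z.
Proof. by rewrite edotDl edotNl. Qed.

Lemma edotDr x y z : edot x (y + z) = edot x y + edot x z.
Proof. by rewrite edotC edotDl !(edotC x). Qed.

Lemma edotZr a x y : edot x (a *: y) = a * edot x y.
Proof. by rewrite edotC edotZl edotC. Qed.

Lemma edotNr x y : edot x (- y) = - edot x y.
Proof. by rewrite edotC edotNl edotC. Qed.

Lemma edotBr x y z : edot x (y - z) = edot x y - edot x z.
Proof. by rewrite edotDr edotNr. Qed.

Lemma edot_ebase x i : edot x (ebase R i) = x ord0 i.
Proof.
rewrite /edot (bigD1 i)//= big1 ?addr0 => [|j ji].
  by rewrite mxE !eqxx mulr1.
by rewrite mxE (negbTE ji) andbF mulr0.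
Qed.

Lemma edot_ge0 x : 0 <= edot x x.
Proof. by apply: sumr_ge0 => i _; rewrite -expr2 sqr_ge0. Qed.

Lemma enormE x : enorm x = Num.sqrt (edot x x).
Proof. by []. Qed.

Lemma enorm_ge0 x : 0 <= enorm x.
Proof. exact: sqrtr_ge0. Qed.

Lemma sqr_enorm x : enorm x ^+ 2 = edot x x.
Proof. by rewrite enormE sqr_sqrtr ?edot_ge0. Qed.

Lemma sqr_enormB x y :
  enorm (x - y) ^+ 2 = enorm x ^+ 2 - 2 * edot x y + enorm y ^+ 2.
Proof. by rewrite !sqr_enorm edotBl !edotBr (edotC y x); ring. Qed.

Lemma enormN x : enorm (- x) = enorm x.
Proof. by rewrite !enormE edotNl edotNr opprK. Qed.

Lemma enorm_distC x y : enorm (x - y) = enorm (y - x).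
Proof. by rewrite -opprB enormN. Qed.

Lemma ler_coord_enorm x i : `|x ord0 i| <= enorm x.
Proof.
rewrite -(ler_pXn2r (ltn0Sn 1)) ?nnegrE ?enorm_ge0//.
rewrite sqr_enorm real_normK ?num_real// /edot (bigD1 i)//= -expr2 lerDl.
by apply: sumr_ge0 => j _; rewrite -expr2 sqr_ge0.
Qed.

Lemma enorm_eq0 x : enorm x = 0 -> x = 0.
Proof.
move=> x0; apply/rowP => i; rewrite mxE; apply/eqP.
by rewrite -normr_le0 -x0 ler_coord_enorm.
Qed.

(** Cauchy-Schwarz, read off from the nonnegative squared norm of [|y| x - |x| y] once the two norms
    are nonzero. *)
Lemma edot_le_enorm x y : edot x y <= enorm x * enorm y.
Proof.
have [/enorm_eq0 ->|x0] := eqVneq (enorm x) 0.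
  by rewrite -(scale0r x) edotZl mul0r mulr_ge0 ?enorm_ge0.
have [/enorm_eq0 ->|y0] := eqVneq (enorm y) 0.
  by rewrite -(scale0r x) edotZr mul0r mulr_ge0 ?enorm_ge0.
have xy : 0 < enorm x * enorm y by rewrite mulr_gt0// lt_neqAle eq_sym ?x0 ?y0 enorm_ge0.
have := edot_ge0 (enorm y *: x - enorm x *: y).
rewrite edotBl !edotBr !edotZl !edotZr -!sqr_enorm (edotC y x).
have -> : enorm y * (enorm y * enorm x ^+ 2) - enorm y * (enorm x * edot x y) -
  (enorm x * (enorm y * edot x y) - enorm x * (enorm x * enorm y ^+ 2)) =
  2 * (enorm x * enorm y) * (enorm x * enorm y - edot x y) by ring.
by rewrite (pmulr_rge0 _ (mulr_gt0 (ltr0n _ 2) xy)) subr_ge0.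
Qed.

Lemma ler_enormD x y : enorm (x + y) <= enorm x + enorm y.
Proof.
rewrite -(ler_pXn2r (ltn0Sn 1)) ?nnegrE ?addr_ge0 ?enorm_ge0//.
rewrite sqr_enorm edotDl !edotDr -!sqr_enorm sqrrD (edotC y x).
by have := edot_le_enorm x y; lra.
Qed.

Lemma edot_cvgl (T : Type) (F : set_system T) (f : T -> V) (l : 'I_N -> R) y :
  Filter F -> (forall i, f t ord0 i @[t --> F] --> l i) ->
  edot (f t) y @[t --> F] --> \sum_i l i * y ord0 i.
Proof.
move=> FF fl; apply: cvg_big => [|i _]; first exact: add_continuous.
by apply: cvgM; [exact: fl|exact: cvg_cst].
Qed.

Lemma enorm_continuous : continuous (@enorm R N).
Proof.
move=> x; apply: (@continuous_comp _ _ _ (fun x : V => \sum_(i < N) x ord0 i ^+ 2) (@Num.sqrt R)).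
  apply: (@cvg_big _ _ _ _ _ _ _ (nbhs x) _ (fun i (y : V) => y ord0 i ^+ 2)) => [|i _].
    exact: add_continuous.
  by apply: cvgM; exact: coord_continuous.
exact: sqrt_continuous.
Qed.

Lemma enorm_sub_continuous c : continuous (fun x => enorm (x - c)).
Proof.
move=> x; apply: (@continuous_comp _ _ _ (fun x => x - c) (@enorm R N)).
  by apply: continuousB; [move=> ? | exact: cst_continuous].
exact: enorm_continuous.
Qed.

(** Both sides have the same difference quotient, so one-variable results (chain rule, mean value
    theorem, Fermat) transfer to directional derivatives. *)
Lemma is_derive_lineP (f : V -> R) x v (t : R) df :
  is_derive t 1 (fun h => f (h *: v + x)) df <-> is_derive (t *: v + x) v f df.
Proof.
have E : (fun h : R => h^-1 *: ((f \o shift (t *: v + x)) (h *: v) - f (t *: v + x)))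
  = (fun h : R => h^-1 *: (((fun h => f (h *: v + x)) \o shift t) (h *: 1) - f (t *: v + x))).
  by apply/funext => h /=; rewrite [_%:A]mulr1 addrA scalerDl.
by split=> -[d1 d2]; split; [move: d1|move: d2|move: d1|move: d2];
  rewrite /derivable /derive E.
Qed.

Lemma is_derive_at_line (f : V -> R) x v df :
  is_derive (0 : R) 1 (fun h => f (h *: v + x)) df -> is_derive x v f df.
Proof. by move/is_derive_lineP; rewrite scale0r add0r. Qed.

Lemma is_derive_comp1 (f : R -> R) (g : V -> R) x v df dg :
  is_derive x v g dg -> is_derive (g x) 1 f df ->
  is_derive x v (f \o g) (df * dg).
Proof.
move=> dgx dfx; apply: is_derive_at_line.
apply: (@is_derive1_comp _ f (fun h => g (h *: v + x))).
  by rewrite scale0r add0r.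
by apply/is_derive_lineP; rewrite scale0r add0r.
Qed.

Lemma is_derive_edot x v y c : is_derive x v (fun z => edot (z - c) y) (edot v y).
Proof.
apply: is_derive_at_line.
have -> : (fun h => edot (h *: v + x - c) y) = (edot v y \*: (@idfun R)) + cst (edot (x - c) y).
  by apply/funext => h; rewrite -(addrA (h *: v)) [LHS]edotDl edotZl mulrC.
by apply: is_derive_eq; rewrite addr0 [_%:A]mulr1.
Qed.

Lemma is_derive_sqr_enorm x v c :
  is_derive x v (fun z => enorm (z - c) ^+ 2) (2 * edot (x - c) v).
Proof.
apply: is_derive_at_line.
have -> : (fun h => enorm (h *: v + x - c) ^+ 2) =
  (edot v v \*: (@idfun R ^+ 2)) + ((2 * edot (x - c) v) \*: (@idfun R)) + cst (edot (x - c) (x - c)).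
  apply/funext => h; rewrite sqr_enorm -(addrA (h *: v)); move: (x - c) => w.
  rewrite !(edotDl, edotDr) !(edotZl, edotZr) (edotC v w).
  by rewrite -[RHS]/(edot v v * (h * h) + 2 * edot w v * h + edot w w); ring.
by apply: is_derive_eq; rewrite /GRing.scale /=; ring.
Qed.

(** The norm is the square root of the polynomial [|z - c|^2], and the square root is differentiable
    away from 0. *)
Lemma is_derive_enorm x v c : 0 < enorm (x - c) ->
  is_derive x v (fun z => enorm (z - c)) (edot (x - c) v / enorm (x - c)).
Proof.
move=> r0.
have -> : (fun z => enorm (z - c)) = Num.sqrt \o (fun z => enorm (z - c) ^+ 2).
  by apply/funext => z /=; rewrite sqrtr_sqr ger0_norm// enorm_ge0.
have d1 := is_derive_sqr_enorm x v c.
have d2 : is_derive (enorm (x - c) ^+ 2) 1 Num.sqrt (2 * Num.sqrt (enorm (x - c) ^+ 2))^-1.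
  by apply: is_derive1_sqrt; rewrite exprn_gt0.
have := is_derive_comp1 d1 d2.
move=> h; apply: is_derive_eq h _.
rewrite sqrtr_sqr ger0_norm ?enorm_ge0//=.
by field; rewrite gt_eqF.
Qed.

End Euclidean.

(** * Functions with a gradient and a Laplacian at a point *)

Section GradLap.
Variables (R : realType) (N : nat).
Local Notation V := 'rV[R]_N.
Implicit Types (x y z v c p : V) (a b : R) (F : V -> R) (G : V -> V).

(** [G] is a field rather than a vector because its components are differentiated to form the
    Laplacian [L], a sum of pure second derivatives. Continuity is recorded separately, since
    directional derivatives do not imply it. This form lets Laplacians of explicit barriers be
    computed by sum and product rules. *)
Definition grad_lap F G (L : R) x : Prop :=
  [/\ {for x, continuous F}, forall v, is_derive x v F (edot (G x) v) &
    exists H : 'I_N -> R,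
      (forall i, is_derive x (ebase R i) (fun y => G y ord0 i) (H i)) /\
      \sum_i H i = L].

Lemma grad_lap_cst a x : grad_lap (cst a) (cst 0) 0 x.
Proof.
split; first exact: cst_continuous.
  by move=> v; apply: is_derive_eq; rewrite edot0l.
exists (fun=> 0); split; last by rewrite big1.
move=> i; have -> : (fun y : V => cst (0 : V) y ord0 i) = cst 0.
  by apply/funext => y; rewrite mxE.
exact: is_derive_cst.
Qed.

Lemma grad_lapD F1 G1 L1 F2 G2 L2 x :
  grad_lap F1 G1 L1 x -> grad_lap F2 G2 L2 x ->
  grad_lap (fun y => F1 y + F2 y) (fun y => G1 y + G2 y) (L1 + L2) x.
Proof.
move=> [c1 d1 [H1 [h1 s1]]] [c2 d2 [H2 [h2 s2]]]; split.
- exact: continuousD.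
- by move=> v; rewrite edotDl; apply: (is_deriveD (d1 v) (d2 v)).
- exists (fun i => H1 i + H2 i); split; last by rewrite big_split /= s1 s2.
  move=> i; have -> : (fun y => (G1 y + G2 y) ord0 i) =
      (fun y => G1 y ord0 i) + (fun y => G2 y ord0 i).
    by apply/funext => y; rewrite mxE.
  exact: (is_deriveD (h1 i) (h2 i)).
Qed.

Lemma grad_lapM F1 G1 L1 F2 G2 L2 x :
  grad_lap F1 G1 L1 x -> grad_lap F2 G2 L2 x ->
  grad_lap (fun y => F1 y * F2 y) (fun y => F1 y *: G2 y + F2 y *: G1 y)
    (F1 x * L2 + F2 x * L1 + 2 * edot (G1 x) (G2 x)) x.
Proof.
move=> [c1 d1 [H1 [h1 s1]]] [c2 d2 [H2 [h2 s2]]]; split.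
- exact: continuousM.
- by move=> v; rewrite edotDl !edotZl; apply: (is_deriveM (d1 v) (d2 v)).
- exists (fun i => F1 x * H2 i + F2 x * H1 i + 2 * (G1 x ord0 i * G2 x ord0 i)); split.
    move=> i; have -> : (fun y => (F1 y *: G2 y + F2 y *: G1 y) ord0 i) =
        F1 * (fun y => G2 y ord0 i) + F2 * (fun y => G1 y ord0 i).
      by apply/funext => y; rewrite !mxE.
    have D1 := d1 (ebase R i); have D2 := d2 (ebase R i).
    apply: (is_derive_eq (is_deriveD (is_deriveM D1 (h2 i)) (is_deriveM D2 (h1 i)))).
    by rewrite !edot_ebase /GRing.scale /=; ring.
  by rewrite !big_split /= -!mulr_sumr s1 s2.
Qed.

Lemma grad_lapZ F G L a x :
  grad_lap F G L x -> grad_lap (fun y => a * F y) (fun y => a *: G y) (a * L) x.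
Proof.
move=> h; have := grad_lapM (grad_lap_cst a x) h.
rewrite /= mulr0 addr0 edot0l mulr0 addr0.
have -> // : (fun y : V => cst a y *: G y + F y *: (cst 0 : V -> V) y) =
  (fun y => a *: G y).
by apply/funext => y; rewrite /= scaler0 addr0.
Qed.

Lemma grad_lapB F1 G1 L1 F2 G2 L2 x :
  grad_lap F1 G1 L1 x -> grad_lap F2 G2 L2 x ->
  grad_lap (fun y => F1 y - F2 y) (fun y => G1 y - G2 y) (L1 - L2) x.
Proof.
move=> h1 h2; have := grad_lapD h1 (grad_lapZ (- 1) h2).
have -> : (fun y => F1 y + -1 * F2 y) = (fun y => F1 y - F2 y).
  by apply/funext => y; rewrite mulN1r.
have -> : (fun y => G1 y + -1 *: G2 y) = (fun y => G1 y - G2 y).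
  by apply/funext => y; rewrite scaleN1r.
by rewrite mulN1r.
Qed.

Lemma is_derive_coord_sub c x v i :
  is_derive x v (fun y => (y - c) ord0 i) (v ord0 i).
Proof.
have -> : (fun y => (y - c) ord0 i) = (fun y => edot (y - c) (ebase R i)).
  by apply/funext => y; rewrite edot_ebase.
by rewrite -(edot_ebase v); exact: is_derive_edot.
Qed.

Lemma ebase_diag (i : 'I_N) : (ebase R i) ord0 i = 1.
Proof. by rewrite mxE !eqxx. Qed.

Lemma grad_lap_sqr_enorm c x :
  grad_lap (fun y => enorm (y - c) ^+ 2) (fun y => 2 *: (y - c)) (2 * N%:R) x.
Proof.
split.
- apply: (@continuous_comp _ _ _ (fun y => enorm (y - c)) (fun t : R => t ^+ 2)).
    exact: enorm_sub_continuous.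
  exact: exprn_continuous.
- by move=> v; rewrite edotZl; exact: is_derive_sqr_enorm.
- exists (fun=> 2); split; last by rewrite sumr_const card_ord mulr_natr.
  move=> i; have -> : (fun y => (2 *: (y - c)) ord0 i) =
      2 \*: (fun y => (y - c) ord0 i).
    by apply/funext => y; rewrite [LHS]mxE.
  apply: (is_derive_eq (is_deriveZ _ (is_derive_coord_sub c x (ebase R i) i))).
  by rewrite ebase_diag [_%:A]mulr1.
Qed.

(** Writing the derivative with the power [k.+2] makes the gradient a radial power times [x - c], so
    the same lemma also yields the second derivatives. *)
Lemma is_derive_radial_pow (rho : R) (k : nat) c x v : rho != 0 -> 0 < enorm (x - c) ->
  is_derive x v (fun y => (rho / enorm (y - c)) ^+ k)
    (- (k%:R / rho ^+ 2) * (rho / enorm (x - c)) ^+ k.+2 * edot (x - c) v).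
Proof.
move=> rho0 r0; have r0' : enorm (x - c) != 0 by rewrite gt_eqF.
have d1 : is_derive (enorm (x - c)) 1 (fun t : R => t^-1) (- enorm (x - c) ^- 2 *: 1).
  exact: (@is_deriveV _ id).
have d2 := is_deriveX k (is_deriveZ rho d1).
have := is_derive_comp1 (is_derive_enorm v r0) d2.
have -> : (rho \*: (fun t : R => t^-1)) ^+ k \o (fun z => enorm (z - c)) =
   (fun y => (rho / enorm (y - c)) ^+ k).
  by apply/funext => y /=; rewrite exprfctE.
move=> h; apply: is_derive_eq h _; rewrite /GRing.scale /=.
(* The power rule produces the exponent [k.-1], so [k = 0] is treated apart. *)
case: k {d2} => [|k /=]; first by rewrite !(mul0r, oppr0).
move: (edot _ _) (enorm _) r0 r0' => e r r0 r0'.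
rewrite !exprMn !exprSr !exprVn.
have rk : rho ^+ k != 0 by rewrite expf_neq0.
have rk' : r ^+ k != 0 by rewrite expf_neq0.
by field; rewrite rho0 r0' rk'.
Qed.

(** The factor [k + 2 - N] decides the sign: the power is harmonic for [k = N - 2] and subharmonic
    for larger [k]. *)
Lemma grad_lap_radial_pow (rho : R) (k : nat) c x : rho != 0 -> 0 < enorm (x - c) ->
  grad_lap (fun y => (rho / enorm (y - c)) ^+ k)
    (fun y => (- (k%:R / rho ^+ 2) * (rho / enorm (y - c)) ^+ k.+2) *: (y - c))
    (k%:R * (k%:R + 2 - N%:R) / rho ^+ 2 * (rho / enorm (x - c)) ^+ k.+2) x.
Proof.
move=> rho0 r0; have r0' : enorm (x - c) != 0 by rewrite gt_eqF.
split.
- apply: (@continuous_comp _ _ _ (fun y => rho / enorm (y - c)) (fun t : R => t ^+ k)).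
    apply: continuousM; first exact: cst_continuous.
    by apply: continuousV => //; exact: enorm_sub_continuous.
  exact: exprn_continuous.
- by move=> v; rewrite edotZl; exact: is_derive_radial_pow.
- set s := rho / enorm (x - c).
  exists (fun i => - (k%:R / rho ^+ 2) * (s ^+ k.+2 -
      (k.+2%:R / rho ^+ 2) * s ^+ k.+4 * (x - c) ord0 i ^+ 2)); split.
    move=> i.
    have -> : (fun y => (- (k%:R / rho ^+ 2) * (rho / enorm (y - c)) ^+ k.+2 *: (y - c)) ord0 i) =
      - (k%:R / rho ^+ 2) \*: ((fun y => (rho / enorm (y - c)) ^+ k.+2) * (fun y => (y - c) ord0 i)).
      by apply/funext => y; rewrite [LHS]mxE -[RHS]/(_ * (_ * _)) mulrA.
    have h1 := is_derive_radial_pow k.+2 (ebase R i) rho0 r0.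
    have h2 := is_derive_coord_sub c x (ebase R i) i.
    apply: (is_derive_eq (is_deriveZ _ (is_deriveM h1 h2))).
    by rewrite edot_ebase ebase_diag /GRing.scale /= -/s; ring.
  rewrite -mulr_sumr sumrB sumr_const card_ord -mulr_sumr.
  have -> : \sum_i (x - c) ord0 i ^+ 2 = enorm (x - c) ^+ 2.
    by rewrite sqr_enorm; apply: eq_bigr.
  (* Eliminating [|x - c|] in favour of [s] leaves a rational identity in [rho] and [s]. *)
  have -> : enorm (x - c) = rho / s.
    by rewrite /s invf_div mulrCA divff ?mulr1.
  rewrite -mulr_natr -(natr1 k.+1) -(natr1 k) !exprSr.
  have s0 : s != 0 by rewrite mulf_neq0 ?invr_eq0.
  by field; rewrite rho0 s0.
Qed.

Lemma is_derive_gradient (u : V -> R) x v : differentiable u x ->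
  is_derive x v u (edot (\row_i partial i u x) v).
Proof.
move=> dux; split; first exact: diff_derivable.
rewrite deriveE// [in LHS](row_sum_delta v) linear_sum.
by apply: eq_bigr => i _; rewrite linearZ /= -deriveE// [RHS]mulrC mxE.
Qed.

Lemma grad_lap_C2 (O : set V) (u : V -> R) x : C2_on O u -> O x ->
  grad_lap u (fun y => \row_i partial i u y) (laplacian u x) x.
Proof.
move=> [du [d2u _]] Ox; split.
- exact/differentiable_continuous/du.
- by move=> v; exact/is_derive_gradient/du.
- exists (fun i => partial i (partial i u) x); split=> // i.
  have -> : (fun y => (\row_j partial j u y) ord0 i) = partial i u.
    by apply/funext => y; rewrite mxE.
  by split; [exact/diff_derivable/d2u|].
Qed.

End GradLap.

(** * Maximum principle and derivatives at the boundary *)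

Section MaximumPrinciple.
Variables (R : realType) (N : nat).
Local Notation V := 'rV[R]_N.
Implicit Types (x y z v c p : V) (a b e : R) (F : V -> R) (G : V -> V).

(** Fermat gives [f1 0 = 0]. If [f2] were positive, [f1] would be positive just to the right of 0,
    and the mean value theorem would give [f t > f 0] there. *)
Lemma local_max_second_derivative (f f1 : R -> R) (f2 e : R) : 0 < e ->
  (forall t : R, `|t| < e -> is_derive t 1 f (f1 t)) -> is_derive (0 : R) 1 f1 f2 ->
  (forall t, `|t| < e -> f t <= f 0) -> f2 <= 0.
Proof.
move=> e0 df df1 fmax.
have e00 : `|0 : R| < e by rewrite normr0.
have f10 : f1 0 = 0.
  have itvE t : t \in `]- e, e[ = (`|t| < e) by rewrite in_itv /= ltr_norml.
  have : is_derive (0 : R) 1 f 0.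
    apply: (@derive1_at_max _ f (- e) e); first by lra.
    - by move=> t; rewrite itvE => /df[].
    - by rewrite itvE.
    - by move=> t; rewrite itvE; exact: fmax.
  by move=> [_ h]; have [_ <-] := df _ e00.
rewrite leNgt; apply/negP => f20.
case: df1 => cv lm.
have /cvgr_gt/(_ _ f20) : h^-1 *: ((f1 \o shift 0) (h *: 1) - f1 0) @[h --> (0 : R)^'] --> f2.
  by rewrite -lm; exact: cv.
rewrite /= => -[d /= d0 hd].
have {}hd h : 0 < h -> h < d -> 0 < f1 h.
  move=> h0 hlt; have := hd h; rewrite /= sub0r normrN gtr0_norm// => /(_ hlt).
  rewrite gt_eqF// => /(_ isT).
  by rewrite addr0 f10 subr0 [_%:A]mulr1 /GRing.scale /= pmulr_rgt0 ?invr_gt0.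
pose t := Num.min d e / 2.
have t0 : 0 < t by rewrite divr_gt0 // lt_min d0.
have m0 : 0 < Num.min d e by rewrite lt_min d0.
have td : t < d.
  by rewrite /t; have : Num.min d e <= d; [rewrite ge_min lexx|lra].
have te : t < e.
  by rewrite /t; have : Num.min d e <= e; [rewrite ge_min lexx orbT|lra].
have [||c] := @MVT R f f1 0 t t0.
- move=> x; rewrite in_itv /= => /andP[x0 xt]; apply: df.
  by rewrite gtr0_norm //; lra.
- apply: derivable_within_continuous => x; rewrite in_itv /= => /andP[x0 xt].
  by have [|] := df x; first by rewrite ger0_norm //; lra.
rewrite in_itv /= => /andP[c0 ct] E.
have : 0 < f1 c * (t - 0) by rewrite mulr_gt0 ?subr_gt0// hd//; lra.
have := fmax t; rewrite gtr0_norm// => /(_ te); lra.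
Qed.

Lemma line_near (O : set V) x v : open O -> O x ->
  exists2 e : R, 0 < e & forall t, `|t| < e -> O (t *: v + x).
Proof.
move=> oO Ox.
have ct : {for (0 : R), continuous (fun t : R => t *: v + x)}.
  apply: continuousD; last exact: cst_continuous.
  exact: scalel_continuous.
have : nbhs ((0 : R) *: v + x) O by rewrite scale0r add0r; exact: open_nbhs_nbhs.
move=> /ct [e /= e0 he]; exists e => // t te; apply: he.
by rewrite /ball_ /= sub0r normrN.
Qed.

(** On each coordinate line through [x] the one-variable test bounds a pure second derivative by 0;
    these add up to [L x]. *)
Lemma local_max_laplacian_le0 (O : set V) F G (L : V -> R) x :
  open O -> (forall z, O z -> grad_lap F G (L z) z) -> O x ->
  (forall z, O z -> F z <= F x) -> L x <= 0.
Proof.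
move=> oO hF Ox Fmax; have [_ _ [H [dH <-]]] := hF x Ox.
apply: sumr_le0 => i _; have [e e0 he] := line_near (ebase R i) oO Ox.
apply: (@local_max_second_derivative (fun t => F (t *: ebase R i + x))
  (fun t => G (t *: ebase R i + x) ord0 i) _ e) => //.
- move=> t /he Ot; apply/is_derive_lineP; have [_ d _] := hF _ Ot.
  by have := d (ebase R i); rewrite edot_ebase.
- by apply/(is_derive_lineP (fun y => G y ord0 i)); rewrite scale0r add0r.
- by move=> t /he; rewrite scale0r add0r; exact: Fmax.
Qed.

Lemma closure_enorm_le (O : set V) c M :
  (forall x, O x -> enorm (x - c) <= M) -> forall x, closure O x -> enorm (x - c) <= M.
Proof.
move=> OM x clx.
have cl : closed [set x | enorm (x - c) <= M].
  apply: (@preimage_closed _ _ (fun x => enorm (x - c)) [set t : R | t <= M]).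
    by move=> y _; exact: enorm_sub_continuous.
  exact: closed_le.
by move: (closureS (OM : O `<=` [set x | enorm (x - c) <= M]) clx); rewrite -(iffLR (closure_id _) cl).
Qed.

(** Adding a small multiple of [|x|^2] makes the Laplacian strictly positive, which excludes an
    interior maximum; the multiple is too small for a positive value of [F] to be compensated at the
    boundary. *)
Lemma weak_maximum_principle (O : set V) F G (L : V -> R) :
  open O -> (exists M : R, forall x, O x -> enorm x <= M) ->
  {within closure O, continuous F} ->
  (forall x, O x -> grad_lap F G (L x) x) -> (forall x, O x -> 0 <= L x) ->
  (0 < N)%N ->
  (forall x, bdry O x -> F x <= 0) -> forall x, O x -> F x <= 0.
Proof.
move=> oO [M OM] cF hF L0 N0 Fb x0 Ox0; rewrite leNgt; apply/negP => Fx0.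
have clM x : closure O x -> enorm (x - 0) <= M.
  by apply: closure_enorm_le => y /OM; rewrite subr0.
have M0 : 0 <= M by exact: le_trans (enorm_ge0 _) (OM _ Ox0).
(* Chosen so that [e M^2 < F x0]; the [+ 1] avoids dividing by 0 when [M = 0]. *)
pose e := F x0 / (M ^+ 2 + 1).
have M1 : 0 < M ^+ 2 + 1 by rewrite ltr_wpDl ?sqr_ge0.
have e0 : 0 < e by rewrite divr_gt0.
have eM : e * M ^+ 2 < F x0.
  have : e * (M ^+ 2 + 1) = F x0 by rewrite /e mulfVK// gt_eqF.
  by rewrite mulrDr mulr1; lra.
pose Fe y := F y + e * enorm (y - 0) ^+ 2.
have hFe z : O z -> grad_lap Fe (fun y => G y + e *: (2 *: (y - 0))) (L z + e * (2 * N%:R)) z.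
  by move=> Oz; apply: grad_lapD; [exact: hF|exact/grad_lapZ/grad_lap_sqr_enorm].
have cFe : {within closure O, continuous Fe}.
  apply/subspace_continuousP => x clx; apply: cvgD.
    by move/subspace_continuousP : cF; exact.
  apply: cvg_within_filter.
  by have [] := grad_lapZ e (grad_lap_sqr_enorm 0 x).
have comp : compact (closure O).
  (* Boundedness refers to the sup norm, which the Euclidean norm dominates. *)
  apply: bounded_closed_compact; last exact: closed_closure.
  exists M; split; first exact: num_real.
  move=> k Mk y /clM; rewrite subr0 => yM.
  rewrite /= [leLHS]/Num.Def.normr /= mx_normrE; apply/bigmax_leP; split => [|[i j] _ /=]; first by lra.
  by rewrite (ord1 i); apply: le_trans (ler_coord_enorm _ _) _; lra.
have [|y] := compact_EVT_max _ comp cFe; first by exists x0; exact: subset_closure.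
rewrite inE => cly ymax.
have ymax' z : closure O z -> Fe z <= Fe y by move=> h; apply: ymax; rewrite inE.
have sqM z : closure O z -> e * enorm (z - 0) ^+ 2 <= e * M ^+ 2.
  by move=> /clM h; rewrite ler_wpM2l ?(ltW e0)// ler_pXn2r ?nnegrE ?enorm_ge0.
(* An interior maximum contradicts a Laplacian of at least [2 N e > 0]. A boundary maximum would
   give [F x0 <= Fe x0 <= Fe y <= e M^2 < F x0]. *)
have [Oy|nOy] := pselect (O y).
  have := @local_max_laplacian_le0 O Fe _ (fun z => L z + e * (2 * N%:R)) y oO hFe Oy.
  move=> /(_ (fun z Oz => ymax' z (subset_closure Oz))) /=.
  have := L0 y Oy.
  have : 0 < e * (2 * N%:R) by rewrite (mulr_gt0 e0)// mulr_gt0 ?ltr0n.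
  lra.
have := ymax' x0 (subset_closure Ox0); have := Fb y (conj cly nOy).
have := sqM y cly; have : 0 <= e * enorm (x0 - 0) ^+ 2 by rewrite mulr_ge0 ?(ltW e0) ?sqr_ge0.
rewrite /Fe; lra.
Qed.

Lemma within_line_continuous (A : set V) F x v b :
  {within A, continuous F} -> (forall t, 0 <= t <= b -> A (t *: v + x)) ->
  {within `[0, b], continuous (fun t => F (t *: v + x))}.
Proof.
move=> /subspace_continuousP cF hA; apply/subspace_continuousP => t.
rewrite /= in_itv /= => /hA At.
apply: (@cvg_comp _ _ _ (fun t => t *: v + x) F _ _ _ _ (cF _ At)).
have ct : {for t, continuous (fun t : R => t *: v + x)}.
  apply: continuousD; last exact: cst_continuous.
  exact: scalel_continuous.
move=> B /= hB; have {}hB := ct _ hB.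
apply: (@filterS _ (nbhs t) _ _ _ _ hB) => s /= h sb; apply: h; apply: hA.
by move: sb; rewrite in_itv.
Qed.

(** This gives [g] its meaning on the boundary, where [u] has no two-sided derivative at hand: by
    the mean value theorem the quotient is the derivative at a point of the open segment, and the
    continuity of [g] up to [p] yields the limit. *)
Lemma boundary_derivative (O : set V) (u : V -> R) (g : 'I_N -> V -> R) p v b :
  C1_closure O u g -> closure O p -> 0 < b ->
  (forall t, 0 < t <= b -> O (t *: v + p)) ->
  (u (t *: v + p) - u p) / t @[t --> (0 : R)^'+] --> edot (\row_i g i p) v.
Proof.
move=> [cu [du cg]] clp b0 hO.
have hcl t : 0 <= t <= b -> closure O (t *: v + p).
  move=> /andP[]; rewrite le_eqVlt => /predU1P[<-|t0 tb].
    by rewrite scale0r add0r.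
  by apply/subset_closure/hO; rewrite t0.
pose D t := edot (\row_i g i (t *: v + p)) v.
have cD : D t @[t --> (0 : R)^'+] --> edot (\row_i g i p) v.
  rewrite /edot; under [X in _ --> X]eq_bigr do rewrite mxE.
  apply: edot_cvgl => i; under eq_fun do rewrite mxE.
  have := within_line_continuous (cg i) hcl.
  move=> /(continuous_within_itvP _ b0)[_ + _].
  by rewrite scale0r add0r.
have dD t : 0 < t <= b -> is_derive t 1 (fun t => u (t *: v + p)) (D t).
  move=> /hO Ot; apply/is_derive_lineP; have [dut gE] := du _ Ot.
  apply: is_derive_eq (is_derive_gradient v dut) _.
  by congr edot; apply/rowP => i; rewrite !mxE gE.
apply/cvgrPdist_lt => eps eps0.
move/cvgrPdist_lt: cD => /(_ _ eps0) [d /= d0 hd].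
exists (Num.min d b); first by rewrite /= lt_min d0.
move=> t; rewrite /= sub0r normrN => tm t0.
rewrite gtr0_norm// lt_min in tm; case/andP: tm => td tb.
have [||c] := @MVT R (fun t => u (t *: v + p)) D 0 t t0.
- move=> s; rewrite in_itv /= => /andP[s0 st]; apply: dD; rewrite s0/=; lra.
- apply: (within_line_continuous cu) => s /andP[s0 st]; apply: hcl; rewrite s0/=; lra.
rewrite in_itv /= => /andP[c0 ct]; rewrite scale0r add0r => ->.
rewrite subr0 mulfK ?gt_eqF//; apply: hd => //=.
by rewrite sub0r normrN gtr0_norm//; lra.
Qed.

End MaximumPrinciple.

(** * Barriers outside a ball *)

Section Barriers.
Variable R : realType.

(** For [s > 0] this says that the convex function [s^(-m)] lies above its tangent at 1. The left
    side decreases in [m], with successive differences [s^m (m + 1) (1 - s)^2]. *)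
Lemma pow_tangent_le1 (s : R) (m : nat) : 0 <= s ->
  s ^+ m * (m.+1%:R - m%:R * s) <= 1.
Proof.
move=> s0; elim: m => [|m IH]; first by rewrite expr0 mul0r subr0 mul1r.
apply: le_trans IH; rewrite -subr_ge0 exprSr -!natr1.
have -> : s ^+ m * (m%:R + 1 - m%:R * s) - s ^+ m * s * (m%:R + 1 + 1 - (m%:R + 1) * s)
   = s ^+ m * (m%:R + 1) * (1 - s) ^+ 2 by ring.
by rewrite mulr_ge0 ?sqr_ge0// mulr_ge0 ?exprn_ge0// natr1.
Qed.

(* Equivalently, the trapezoid rule [n (1 + s^(n+1)) >= 2 (s + ... + s^n)],
   multiplied by [1 - s]. *)
Lemma pow_trapezoid_ge0 (s : R) (n : nat) : 0 <= s -> s <= 1 ->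
  0 <= n%:R - n.+2%:R * s + n.+2%:R * s ^+ n.+1 - n%:R * s ^+ n.+2.
Proof.
move=> s0 s1; elim: n => [|n IH]; first by rewrite expr1; lra.
(* The increment from [n] to [n + 1] is [1 - s] times the gap in the tangent inequality. *)
have := pow_tangent_le1 n.+1 s0; rewrite -subr_ge0.
have : 0 <= 1 - s by rewrite subr_ge0.
move=> a b; have := addr_ge0 IH (mulr_ge0 a b).
rewrite !exprSr -!natr1; set t := s ^+ n.
by move=> h; apply: le_trans h _; rewrite le_eqVlt; apply/orP; left; apply/eqP; ring.
Qed.

(** The last hypothesis gives [1 + e / 2 >= (1 + s) / (2 s)]; with this smaller factor the claim is
    the trapezoid inequality. It gives the sign of the last summand of the barrier for [N >= 4],
    with [s = re / |x - c|] and [e = d / re]. *)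
Lemma pow_mean_le (s e : R) (n : nat) : (0 < n)%N -> 0 < s -> s <= 1 -> 1 <= s * (1 + e) ->
  (1 - s ^+ n) / n%:R <= (1 + e / 2) * ((1 - s ^+ n.+1) / n.+1%:R).
Proof.
move=> n0 s0 s1 se.
have n0' : 0 < n%:R :> R by rewrite ltr0n.
have n1' : 0 < n.+1%:R :> R by rewrite ltr0n.
have B := pow_trapezoid_ge0 n (ltW s0) s1.
have P : 0 <= 1 - s ^+ n.+1 by rewrite subr_ge0 exprn_ile1 ?(ltW s0).
rewrite mulrA ler_pdivlMr// mulrAC ler_pdivrMr//.
rewrite -(ler_pM2l s0) -(ler_pM2l (ltr0n R 2)).
(* The slack coming from [s (1 + e) >= 1], to be added to the trapezoid inequality [B]. *)
have H : 0 <= (s * (1 + e) - 1) * (1 - s ^+ n.+1) * n%:R.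
  by rewrite !mulr_ge0 ?subr_ge0 ?(ltW n0')// -subr_ge0.
rewrite -subr_ge0; apply: le_trans (addr_ge0 B H) _.
rewrite le_eqVlt; apply/orP; left; apply/eqP.
by rewrite !exprSr -!natr1; set t := s ^+ n; field.
Qed.

Variable N : nat.
Local Notation V := 'rV[R]_N.

(** When [|p - c| = re] and [K >= 0], the vector [G p] has norm [K] and points to the centre of the
    exterior ball. The region in the last clause contains the closure of the domain when [d] is its
    diameter. *)
Definition barrier (d re K : R) (c p : V) (W : V -> R) (G : V -> V) (L : V -> R) :=
  [/\ W p = 0, G p = - (K / re) *: (p - c),
    (forall x, re <= enorm (x - c) -> grad_lap W G (L x) x) &
    (forall x, re <= enorm (x - c) -> enorm (x - p) <= d -> N%:R <= L x /\ W x <= 0)].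

(* The barrier is [(r^2 - re^2)/2 - C (1 - re/r)] with [r = |x - c|] and [C]
   chosen so that it vanishes at [r = re] and [r = re + d]. *)
Lemma barrier_low_dim (d re : R) (c p : V) : (N <= 3)%N -> 0 <= d -> 0 < re ->
  enorm (p - c) = re ->
  exists W G L, barrier d re (d * (d + 3 * re) / (2 * re)) c p W G L.
Proof.
move=> N3 d0 re0 pc; have re0' : re != 0 by rewrite gt_eqF.
pose C := (re + d) * (re + d + re) / 2.
have C0 : 0 <= C by rewrite divr_ge0// mulr_ge0//; lra.
exists (fun y => 2^-1 * enorm (y - c) ^+ 2 + C * (re / enorm (y - c)) ^+ 1 + cst (- (re ^+ 2 / 2) - C) y).
exists (fun y => 2^-1 *: (2 *: (y - c)) +
  C *: ((- (1%:R / re ^+ 2) * (re / enorm (y - c)) ^+ 3) *: (y - c)) + cst 0 y).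
exists (fun x => 2^-1 * (2 * N%:R) + C * (1%:R * (1%:R + 2 - N%:R) / re ^+ 2 * (re / enorm (x - c)) ^+ 3) + 0).
split.
- by rewrite pc divff//= expr1n; field.
- rewrite pc divff//= expr1n addr0 !scalerA -scalerDl; congr (_ *: _).
  (* The slope comes from [C - re^2 = d (d + 3 re) / 2]. *)
  by rewrite /C; field.
- move=> x xc; have x0 : 0 < enorm (x - c) by lra.
  apply: grad_lapD; last exact: grad_lap_cst.
  apply: grad_lapD; first exact/grad_lapZ/grad_lap_sqr_enorm.
  exact/grad_lapZ/grad_lap_radial_pow.
- move=> x xc xp; have x0 : 0 < enorm (x - c) by lra.
  have xR : enorm (x - c) <= re + d.
    by have := ler_enormD (x - p) (p - c); rewrite subrKA pc; lra.
  move: (enorm (x - c)) xc x0 xR => r xc x0 xR; split.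
    (* The Laplacian is [N] plus a nonnegative multiple of [3 - N]; this is where [N <= 3]
       enters. *)
    rewrite addr0 mulKf ?pnatr_eq0// lerDl mulr_ge0// mulr_ge0//; last first.
      by rewrite exprn_ge0// divr_ge0 ?(ltW re0) ?(ltW x0).
    rewrite divr_ge0 ?sqr_ge0// mul1r subr_ge0.
    by have : N%:R <= 3%:R :> R; [rewrite ler_nat|lra].
  rewrite expr1 /=.
  have -> : 2^-1 * r ^+ 2 + C * (re / r) + (- (re ^+ 2 / 2) - C) =
    - ((r - re) / (2 * r) * ((re + d) * (re + d + re) - (r + re) * r)).
    by rewrite /C; field; rewrite gt_eqF.
  rewrite oppr_le0 mulr_ge0// ?divr_ge0 ?subr_ge0//; first by lra.
  have : (r + re) * r <= (re + d + re) * (re + d) by rewrite ler_pM//; lra.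
  by lra.
Qed.

End Barriers.

(* With [s = re / |x - c|] and [q = (|x - p|^2 - d^2) / 2], the barrier is
   [q (1 - s^(N-1)) + N re^2 ((1 - s^n) / n - (1 + d / (2 re)) (1 - s^(n+1)) / (n + 1))],
   [n = N - 3].  The last summand has Laplacian [N s^(N-1)], which makes up for
   the factor of [q]; the term in [s^(n+1)] is harmonic.  (The torsion function
   of an annulus gives a worse constant when [N > 7].) *)
Lemma barrier_high_dim (R : realType) (n : nat) (d re : R) (c p : 'rV[R]_n.+3) :
  (0 < n)%N -> 0 <= d -> 0 < re ->
  enorm (p - c) = re ->
  exists W G L, barrier d re (n.+2%:R * d ^+ 2 / (2 * re) + n.+3%:R * d / 2) c p W G L.
Proof.
move=> n0 d0 re0 pc; have re0' : re != 0 by rewrite gt_eqF.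
have n0' : n%:R != 0 :> R by rewrite pnatr_eq0 -lt0n.
have n1' : n%:R + 1 != 0 :> R by rewrite natr1 pnatr_eq0.
pose e := d / re.
pose q (y : 'rV[R]_n.+3) := 2^-1 * enorm (y - p) ^+ 2 + cst (- (d ^+ 2 / 2)) y.
pose Gq (y : 'rV[R]_n.+3) := 2^-1 *: (2 *: (y - p)) + cst 0 y.
pose S k (y : 'rV[R]_n.+3) := (re / enorm (y - c)) ^+ k.
pose GS k (y : 'rV[R]_n.+3) :=
  (- (k%:R / re ^+ 2) * (re / enorm (y - c)) ^+ k.+2) *: (y - c).
pose LS (k : nat) (x : 'rV[R]_n.+3) : R :=
  k%:R * (k%:R + 2 - n.+3%:R) / re ^+ 2 * (re / enorm (x - c)) ^+ k.+2.
(* As [S n] has Laplacian [- n s^(n+2) / re^2], this [a] makes [a * S n] contribute [N s^(n+2)],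
   with [N = n + 3]. The harmonic term with coefficient [b] then only adjusts the sign. *)
pose a := - (n.+3%:R * re ^+ 2 / n%:R) : R.
pose b := n.+3%:R * re ^+ 2 * (1 + e / 2) / n.+1%:R : R.
exists (fun y => q y - q y * S n.+2 y + (a * S n y + b * S n.+1 y + cst (- (a + b)) y)).
exists (fun y => Gq y - (q y *: GS n.+2 y + S n.+2 y *: Gq y)
  + (a *: GS n y + b *: GS n.+1 y + cst 0 y)).
exists (fun x => (2^-1 * (2 * n.+3%:R) + 0) -
   (q x * LS n.+2 x + S n.+2 x * (2^-1 * (2 * n.+3%:R) + 0) + 2 * edot (Gq x) (GS n.+2 x))
  + (a * LS n x + b * LS n.+1 x + 0)).
have Gqp : Gq p = 0 by rewrite /Gq subrr !scaler0 addr0.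
have qp : q p = - (d ^+ 2 / 2).
  by rewrite /q subrr sqr_enorm edot0l mulr0 add0r.
split.
- rewrite /S pc divff// !expr1n /=; ring.
(* At [p] the gradient of [q] vanishes and [s = 1]: the term [- q * S n.+2] gives the [d^2] part of
   [K], and [S n] and [S n.+1] together give the part linear in [d]. *)
- rewrite Gqp scaler0 addr0 sub0r addr0 /GS pc divff// !expr1n qp.
  rewrite !scalerA -scaleNr -!scalerDl; congr (_ *: _).
  rewrite /a /b /e -!natr1; field.
  by rewrite re0' n0' n1'.
- move=> x xc; have x0 : 0 < enorm (x - c) by lra.
  have hq : grad_lap q Gq (2^-1 * (2 * n.+3%:R) + 0) x.
    apply: grad_lapD; last exact: grad_lap_cst.
    exact/grad_lapZ/grad_lap_sqr_enorm.
  have hS k : grad_lap (S k) (GS k) (LS k x) x by exact: grad_lap_radial_pow.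
  apply: grad_lapD; first by apply: grad_lapB => //; exact: grad_lapM.
  by apply: grad_lapD; [apply: grad_lapD; exact: grad_lapZ|exact: grad_lap_cst].
- move=> x xc xp; have x0 : 0 < enorm (x - c) by lra.
  have xR : enorm (x - c) <= re + d.
    by have := ler_enormD (x - p) (p - c); rewrite subrKA pc; lra.
  have qx : q x <= 0.
    rewrite /q /= -mulrC -mulNr -mulrDl.
    have : enorm (x - p) ^+ 2 <= d ^+ 2 by rewrite ler_pXn2r ?nnegrE ?enorm_ge0.
    by lra.
  pose s := re / enorm (x - c).
  have s0 : 0 < s by rewrite divr_gt0.
  have s1 : s <= 1 by rewrite ler_pdivrMr// mul1r.
  have se : 1 <= s * (1 + e).
    by rewrite /s /e mulrAC ler_pdivlMr// mul1r mulrDr mulr1 mulrCA divff// mulr1.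
  split.
    (* This makes the cross term of the product rule favourable: by Cauchy-Schwarz the product is at
       least [|x - c| (|x - c| - re)]. *)
    have dot0 : 0 <= edot (x - p) (x - c).
      have -> : x - p = (x - c) - (p - c) by rewrite opprB addrA subrK.
      rewrite edotBl -sqr_enorm (edotC (p - c)).
      have := edot_le_enorm (x - c) (p - c); rewrite pc.
      have : enorm (x - c) * re <= enorm (x - c) * enorm (x - c) by rewrite ler_pM2l.
      by rewrite expr2; lra.
    have -> : 2 * edot (Gq x) (GS n.+2 x) = - (2 * n.+2%:R / re ^+ 2 * s ^+ n.+4 * edot (x - p) (x - c)).
      rewrite /Gq /= addr0 scalerA mulVf ?pnatr_eq0// scale1r /GS edotZr -/s.
      by ring.
    have T1 : 0 <= 2 * n.+2%:R / re ^+ 2 * s ^+ n.+4 * edot (x - p) (x - c).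
      rewrite mulr_ge0// mulr_ge0 ?exprn_ge0 ?(ltW s0)//.
      by rewrite divr_ge0 ?sqr_ge0// mulr_ge0 ?ler0n.
    (* [S n.+2] is subharmonic, its exponent being [N - 1], and [q x <= 0]. *)
    have T2 : 0 <= - q x * LS n.+2 x.
      rewrite mulr_ge0 ?oppr_ge0// /LS -/s mulr_ge0 ?exprn_ge0 ?(ltW s0)//.
      rewrite divr_ge0 ?sqr_ge0// mulr_ge0 ?ler0n//.
      by rewrite -!natr1; lra.
    have T3 : a * LS n x + b * LS n.+1 x = n.+3%:R * s ^+ n.+2.
      rewrite /LS -/s /a /b -!natr1 !exprSr; field.
      by rewrite re0' n0' n1'.
    move: T1 T2 T3; rewrite /S -/s; move: (2 * n.+2%:R / _ * _ * _) (LS _ _) => t1 t2 T1 T2.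
    move=> T3; rewrite addr0 T3; lra.
  have T1 : q x - q x * S n.+2 x <= 0.
    rewrite -{1}(mulr1 (q x)) -mulrBr mulr_le0_ge0// subr_ge0 /S -/s.
    by rewrite exprn_ile1 ?(ltW s0).
  suff : a * S n x + b * S n.+1 x - (a + b) <= 0 by move: T1 => /=; lra.
  have -> : a * S n x + b * S n.+1 x - (a + b) =
     n.+3%:R * re ^+ 2 * ((1 - s ^+ n) / n%:R - (1 + e / 2) * ((1 - s ^+ n.+1) / n.+1%:R)).
    rewrite /a /b /S -/s -!natr1; field.
    by rewrite n0' n1'.
  apply: mulr_ge0_le0; first by rewrite mulr_ge0 ?sqr_ge0.
  by rewrite subr_le0; exact: pow_mean_le.
Qed.

(** * Comparison with the solution *)

Section GradientBounds.
Variables (R : realType) (N : nat) (O : set 'rV[R]_N).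
Variables (u : 'rV[R]_N -> R) (g : 'I_N -> 'rV[R]_N -> R).
Local Notation V := 'rV[R]_N.
Implicit Types (x y z v c p : V).

Hypothesis N_gt0 : (0 < N)%N.
Hypothesis domO : bounded_domain O.
Hypothesis C1u : C1_closure O u g.
Hypothesis C2u : C2_on O u.
Hypothesis lap_u : forall x, O x -> laplacian u x = N%:R.
Hypothesis u_bdry : forall x, bdry O x -> u x = 0.

Let grad p : V := \row_i g i p.

Lemma enorm_le_diameter x y : closure O x -> closure O y -> enorm (x - y) <= diameter O.
Proof.
case: domO => oO [_ [[x0 Ox0] [M OM]]].
(* A supremum dominates the distances once these are bounded above; [2 M] is a bound. *)
have H : has_ubound [set d | exists x y, O x /\ O y /\ d = enorm (x - y)].
  exists (M + M) => _ [a [b [Oa [Ob ->]]]].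
  apply: le_trans (ler_enormD _ _) _; rewrite enormN.
  by apply: lerD; exact: OM.
move=> clx cly; move: x clx; apply: closure_enorm_le => x Ox.
rewrite enorm_distC; move: y cly; apply: closure_enorm_le => y Oy.
by apply: ub_le_sup => //; exists y, x.
Qed.

Lemma solution_le0 x : closure O x -> u x <= 0.
Proof.
have [oO [_ [_ bO]]] := domO.
have [cu _] := C1u.
have u0 : forall x, O x -> u x <= 0.
  apply: (@weak_maximum_principle _ _ _ _ (fun y => \row_i partial i u y) (laplacian u)) => //.
  - by move=> y Oy; exact: grad_lap_C2 C2u Oy.
  - by move=> y Oy; rewrite lap_u.
  - by move=> y bdy; rewrite u_bdry.
move=> clx; have [/u0//|nOx] := pselect (O x).
by rewrite u_bdry.
Qed.

Lemma is_derive_at_right (W : V -> R) p v D : is_derive p v W D ->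
  (W (t *: v + p) - W p) / t @[t --> (0 : R)^'+] --> D.
Proof.
move=> [cv lm].
have : h^-1 *: ((W \o shift p) (h *: v) - W p) @[h --> (0 : R)^'] --> D.
  by rewrite -lm; exact: cv.
have -> : (fun t => (W (t *: v + p) - W p) / t) =
    (fun h => h^-1 *: ((W \o shift p) (h *: v) - W p)).
  by apply/funext => h; rewrite /= mulrC.
exact: cvg_dnbhs_at_right.
Qed.

Lemma le_boundary_derivative (W : V -> R) p v D b : closure O p -> 0 < b ->
  (forall t, 0 < t <= b -> O (t *: v + p)) -> is_derive p v W D -> W p = u p ->
  (forall y, O y -> W y <= u y) -> D <= edot (grad p) v.
Proof.
move=> clp b0 hO dW Wp Wu.
apply: (ler_cvg_to (is_derive_at_right dW) (boundary_derivative C1u clp b0 hO)).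
near=> t; have t0 : 0 < t by near: t; exact: nbhs_right_gt.
rewrite ler_pM2r ?invr_gt0// Wp lerD2r; apply/Wu/hO; rewrite t0 /=.
by near: t; exact: nbhs_right_le.
Unshelve. all: by end_near. Qed.

Lemma ge_boundary_derivative (W : V -> R) p v D b : closure O p -> 0 < b ->
  (forall t, 0 < t <= b -> O (t *: v + p) /\ u (t *: v + p) <= W (t *: v + p)) ->
  is_derive p v W D -> W p = u p -> edot (grad p) v <= D.
Proof.
move=> clp b0 hO dW Wp.
have hO' t : 0 < t <= b -> O (t *: v + p) by move=> /hO[].
apply: (ler_cvg_to (boundary_derivative C1u clp b0 hO') (is_derive_at_right dW)).
near=> t; have t0 : 0 < t by near: t; exact: nbhs_right_gt.
rewrite ler_pM2r ?invr_gt0// Wp lerD2r; apply: (hO t _).2; rewrite t0 /=.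
by near: t; exact: nbhs_right_le.
Unshelve. all: by end_near. Qed.

Lemma open_eball c (r : R) : open (eball c r).
Proof.
apply: (@open_comp _ _ (fun x => enorm (x - c)) [set t : R | t < r]).
  by move=> y _; exact: enorm_sub_continuous.
exact: open_lt.
Qed.

(** The difference of the two sides is harmonic in the ball. On its boundary [u <= 0], which holds
    on all of the closure of [O], while the quadratic is nonnegative. *)
Lemma solution_le_interior_ball c (r : R) : eball c r `<=` O ->
  forall x, eball c r x -> u x <= 2^-1 * enorm (x - c) ^+ 2 - r ^+ 2 / 2.
Proof.
move=> cO.
have [cu _] := C1u.
pose W (y : V) := 2^-1 * enorm (y - c) ^+ 2 - cst (r ^+ 2 / 2) y.
have hW x : grad_lap W (fun y => 2^-1 *: (2 *: (y - c)) - cst 0 y) (2^-1 * (2 * N%:R) - 0) x.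
  apply: grad_lapB; last exact: grad_lap_cst.
  exact/grad_lapZ/grad_lap_sqr_enorm.
suff h x : eball c r x -> u x - W x <= 0 by move=> x /h; rewrite /W /=; lra.
apply: (@weak_maximum_principle _ _ _ (fun y => u y - W y)
  (fun y => (\row_i partial i u y) - (2^-1 *: (2 *: (y - c)) - cst 0 y))
  (fun x => laplacian u x - (2^-1 * (2 * N%:R) - 0))) => //.
- exact: open_eball.
- exists (r + enorm c) => y; rewrite /eball /= => yc.
  have := ler_enormD (y - c) c; rewrite subrK; lra.
- have clO : closure (eball c r) `<=` closure O by exact: closureS.
  apply/subspace_continuousP => y cly; apply: cvgB.
    move/(continuous_subspaceW clO)/subspace_continuousP : cu; exact.
  by apply: cvg_within_filter; have [] := hW y.
- by move=> y yc; apply: grad_lapB (hW y); exact: grad_lap_C2 C2u (cO _ yc).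
- by move=> y /cO /lap_u ->; rewrite subr0 mulKf ?pnatr_eq0// subrr.
- move=> y [cly /negP]; rewrite -leNgt => ry.
  have := solution_le0 (closureS cO cly).
  suff : 0 <= W y by lra.
  rewrite /W /= mulrC -mulrBl divr_ge0// subr_ge0.
  (* For negative [r] the ball is empty and has no closure point. *)
  have [r0|r0] := leP 0 r; first by rewrite ler_pXn2r ?nnegrE ?enorm_ge0.
  have [z [/=]] := cly setT filterT.
  by have := enorm_ge0 (z - c); rewrite /eball /=; lra.
Qed.

Lemma enorm_interior_sphere c (r : R) p : eball c r `<=` O -> bdry O p -> ecball c r p ->
  enorm (p - c) = r.
Proof.
move=> cO [_ nOp] pc; apply/eqP; rewrite eq_le pc leNgt; apply/negP => h.
exact/nOp/cO.
Qed.

(** The comparison with the quadratic is differentiated along the radius from [p] to [c], where the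
    quadratic has derivative [- r^2]. *)
Lemma boundary_gradient_interior c (r : R) p : 0 < r -> eball c r `<=` O -> bdry O p ->
  enorm (p - c) = r -> r ^+ 2 <= edot (grad p) (p - c).
Proof.
move=> r0 cO bp pc.
rewrite -opprB edotNr lerNr; have [clp _] := bp.
have seg t : 0 < t <= 1 -> eball c r (t *: (c - p) + p).
  move=> /andP[t0 t1]; rewrite /eball /=.
  have -> : t *: (c - p) + p - c = (1 - t) *: (p - c).
    by rewrite -(opprB p c) scalerN scalerBl scale1r -[LHS]addrA [LHS]addrC.
  rewrite -(ltr_pXn2r (ltn0Sn 1)) ?nnegrE ?enorm_ge0 ?(ltW r0)//.
  rewrite sqr_enorm edotZl edotZr -sqr_enorm pc mulrA gtr_pMl ?exprn_gt0//.
  by nra.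
pose W (y : V) := 2^-1 * enorm (y - c) ^+ 2 - cst (r ^+ 2 / 2) y.
have [_ dW _] : grad_lap W (fun y => 2^-1 *: (2 *: (y - c)) - cst 0 y) (2^-1 * (2 * N%:R) - 0) p.
  apply: grad_lapB; last exact: grad_lap_cst.
  exact/grad_lapZ/grad_lap_sqr_enorm.
have := @ge_boundary_derivative W p (c - p) _ 1 clp ltr01 _ (dW (c - p)).
rewrite /= subr0 scalerA mulVf ?pnatr_eq0// scale1r -(opprB p c) !edotNr -sqr_enorm pc.
apply; last by rewrite u_bdry// /W pc /= mulrC subrr.
move=> t; rewrite opprB => /seg ht; split; first exact: cO.
exact: solution_le_interior_ball cO _ ht.
Qed.

(** The maximum principle applies to [W - u]: its Laplacian is [L - N >= 0], and on the boundary it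
    equals [W <= 0]. *)
Lemma barrier_le_solution (d re K : R) c p W G L : barrier d re K c p W G L ->
  (forall x, closure O x -> re <= enorm (x - c)) ->
  (forall x, closure O x -> enorm (x - p) <= d) ->
  forall x, O x -> W x <= u x.
Proof.
move=> [_ _ hW hLW] Ore Od.
have [oO [_ [_ bO]]] := domO.
have [cu _] := C1u.
suff h x : O x -> W x - u x <= 0 by move=> x /h; rewrite subr_le0.
apply: (@weak_maximum_principle _ _ _ (fun y => W y - u y)
  (fun y => G y - (\row_i partial i u y)) (fun x => L x - laplacian u x)) => //.
- apply/subspace_continuousP => y cly; apply: cvgB.
    by apply: cvg_within_filter; have [] := hW y (Ore _ cly).
  by move/subspace_continuousP : cu; exact.
- move=> y Oy; apply: grad_lapB; last exact: grad_lap_C2 C2u Oy.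
  by apply: hW; apply: Ore; exact: subset_closure.
- move=> y Oy; rewrite lap_u// subr_ge0.
  by have [] := hLW y (Ore _ (subset_closure Oy)) (Od _ (subset_closure Oy)).
- move=> y bdy; rewrite u_bdry// subr0; have [cly _] := bdy.
  by have [] := hLW y (Ore _ cly) (Od _ cly).
Qed.

(* [- grad p] points into the interior ball, so the comparison [W <= u] may be
   differentiated in that direction. *)
Lemma boundary_gradient_barrier (ri d re K : R) ci c p W G L :
  0 < ri -> eball ci ri `<=` O -> bdry O p -> enorm (p - ci) = ri ->
  0 < re -> 0 <= K -> enorm (p - c) = re ->
  barrier d re K c p W G L ->
  (forall x, closure O x -> re <= enorm (x - c)) ->
  (forall x, closure O x -> enorm (x - p) <= d) ->
  enorm (grad p) <= K.
Proof.
move=> ri0 ciO bp pci re0 K0 pc bW Ore Od; have [clp _] := bp.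
have gi := boundary_gradient_interior ri0 ciO bp pci.
have Wu := barrier_le_solution bW Ore Od.
case: bW => Wp Gp hW _.
have [_ dW _] := hW p (Ore _ clp).
have ri2 : 0 < ri ^+ 2 by rewrite exprn_gt0.
have gn : 0 < enorm (grad p).
  rewrite lt_neqAle enorm_ge0 andbT eq_sym; apply/eqP => /enorm_eq0 g0.
  by move: gi; rewrite g0 edot0l; lra.
have g2 : 0 < enorm (grad p) ^+ 2 by rewrite exprn_gt0.
(* Here [|p - ci - t grad p|^2 <= ri^2 - 2 t ri^2 + t^2 |grad p|^2], and the bound on [t] makes the
   last term at most [t ri^2]. *)
have seg t : 0 < t <= ri ^+ 2 / enorm (grad p) ^+ 2 -> O (t *: - grad p + p).
  move=> /andP[t0 t1]; apply: ciO; rewrite /eball /=.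
  rewrite -(ltr_pXn2r (ltn0Sn 1)) ?nnegrE ?enorm_ge0 ?(ltW ri0)//.
  have -> : t *: - grad p + p - ci = (p - ci) - t *: grad p.
    by rewrite scalerN -[LHS]addrA [LHS]addrC.
  rewrite sqr_enormB pci edotZr (edotC (p - ci)).
  rewrite (sqr_enorm (_ *: _)) edotZl edotZr -sqr_enorm.
  rewrite ler_pdivlMr// in t1.
  have : t * ri ^+ 2 <= t * edot (grad p) (p - ci) by rewrite ler_pM2l.
  have : t * (t * enorm (grad p) ^+ 2) <= t * ri ^+ 2 by rewrite ler_pM2l.
  have : 0 < t * ri ^+ 2 by rewrite mulr_gt0.
  lra.
have := @le_boundary_derivative W p (- grad p) _ _ clp (divr_gt0 ri2 g2) seg (dW _).
rewrite u_bdry// => /(_ Wp Wu).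
rewrite Gp edotZl !edotNr mulrNN -sqr_enorm.
(* By Cauchy-Schwarz, the derivative of [W] along [- grad p] is at least [- K |grad p|]. *)
have : - (re * enorm (grad p)) <= edot (p - c) (grad p).
  by have := edot_le_enorm (- (p - c)) (grad p); rewrite edotNl enormN pc; lra.
have Kre : 0 <= K / re by rewrite divr_ge0// ltW.
move=> /(ler_wpM2l Kre) h1 h2.
have : enorm (grad p) ^+ 2 <= K * enorm (grad p).
  have -> : K * enorm (grad p) = K / re * (re * enorm (grad p)).
    by field; rewrite gt_eqF.
  by lra.
by rewrite expr2 ler_pM2r.
Qed.

End GradientBounds.

(** The slopes of the two barriers stay below the stated constant by exactly [d^2 / re] for [N <= 3]
    and [d^2 / (2 re)] for [N >= 4]. *)
Lemma barrier_exists (R : realType) (N : nat) (d re : R) (c p : 'rV[R]_N) :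
  (2 <= N)%N -> 0 <= d -> 0 < re -> enorm (p - c) = re ->
  exists K W G L, [/\ 0 <= K, K <= cN R N * (d * (d + re) / re) & barrier d re K c p W G L].
Proof.
move=> N2 d0 re0 pc; have re0' : re != 0 by rewrite gt_eqF.
have [N3|N3] := leqP N 3.
  have [W [G [L bW]]] := barrier_low_dim N3 d0 re0 pc.
  exists (d * (d + 3 * re) / (2 * re)), W, G, L; split => //.
    by rewrite divr_ge0 ?mulr_ge0 ?addr_ge0 ?mulr_ge0 ?(ltW re0).
  (* Both clauses of the definition give [3 / 2] here, as [N / 2 = 3 / 2] for [N = 3]. *)
  have -> : cN R N = 3 / 2.
    by rewrite /cN; move: N2 N3 {bW W G L pc c p}; case: N => [|[|[|[|?]]]].
  rewrite -subr_ge0.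
  have -> : 3 / 2 * (d * (d + re) / re) - d * (d + 3 * re) / (2 * re) = d ^+ 2 / re.
    by field.
  by rewrite divr_ge0 ?sqr_ge0 ?ltW.
case: N c p pc N2 N3 => [|[|[|n]]]// c p pc _ n0.
have [W [G [L bW]]] := barrier_high_dim (n0 : (0 < n)%N) d0 re0 pc.
exists (n.+2%:R * d ^+ 2 / (2 * re) + n.+3%:R * d / 2), W, G, L; split => //.
  by rewrite addr_ge0// divr_ge0// mulr_ge0 ?sqr_ge0 ?(ltW re0).
rewrite /cN /= -subr_ge0.
have -> : n.+3%:R / 2 * (d * (d + re) / re) - (n.+2%:R * d ^+ 2 / (2 * re) + n.+3%:R * d / 2) = d ^+ 2 / (2 * re).
  by rewrite -!natr1; field.
by rewrite divr_ge0 ?sqr_ge0 ?mulr_ge0 ?(ltW re0).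
Qed.

Theorem theorem3p10 (R : realType) (N : nat) (O : set 'rV[R]_N)
  (ri re : R) (u : 'rV[R]_N -> R) (g : 'I_N -> 'rV[R]_N -> R) :
  (2 <= N)%N ->
  bounded_domain O ->
  0 < ri -> interior_sphere O ri ->
  0 < re -> exterior_sphere O re ->
  C1_closure O u g -> C2_on O u ->
  (forall x, O x -> laplacian u x = N%:R) ->
  (forall x, bdry O x -> u x = 0) ->
  forall p, bdry O p ->
    ri <= enorm (\row_i g i p) /\
    enorm (\row_i g i p) <= cN R N * (diameter O * (diameter O + re) / re).
Proof.
move=> N2 domO ri0 intO re0 extO C1u C2u lapu ub p bp; have [clp _] := bp.
have N0 : (0 < N)%N by exact: leq_trans N2.
have [ci [ciO ciE]] := intO p bp.
have [ce [ceO ceE]] := extO p bp.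
have [ciB ceB] : ecball ci ri p /\ ecball ce re p.
  have h : [set p] p by [].
  by split; [move: h; rewrite -ciE => -[]|move: h; rewrite -ceE => -[]].
have pci := enorm_interior_sphere ciO bp ciB.
have Ore x : closure O x -> re <= enorm (x - ce).
  by move=> clx; rewrite leNgt; apply/negP => /ceO.
have pce : enorm (p - ce) = re by apply/eqP; rewrite eq_le Ore// andbT.
have Od x : closure O x -> enorm (x - p) <= diameter O.
  by move=> clx; exact: enorm_le_diameter.
split.
  (* Cauchy-Schwarz turns this into [ri^2 <= |grad u(p)| ri]. *)
  have := boundary_gradient_interior N0 domO C1u C2u lapu ub ri0 ciO bp pci.
  move=> h; have := le_trans h (edot_le_enorm _ _); rewrite pci expr2.
  by rewrite ler_pM2r.
have d0 : 0 <= diameter O by exact: le_trans (enorm_ge0 _) (Od p clp).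
have [K [W [G [L [K0 Kle bW]]]]] := barrier_exists N2 d0 re0 pce.
apply: le_trans Kle.
exact (boundary_gradient_barrier N0 domO C1u C2u lapu ub ri0 ciO bp pci re0 K0 pce bW Ore Od).
Qed.
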